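(* Let $\alpha,k,q,\tau,\varepsilon>0$ and the network (hence $\lambda_2,\dots,\lambda_n$) be fixed, and regard the losses $\|\mathcal{S}^{\mathrm{DAPI}}_P\|_2^2$ and $\|\mathcal{S}^{\mathrm{DAPI}}\|_2^2=\|\mathcal{S}^{\mathrm{DAPI}}_P\|_2^2+\|\mathcal{S}^{\mathrm{DAPI}}_\eta\|_2^2$, as given in the context, as functions of the interaction strength $\gamma$. Let $\gamma^{\star,\eta}$ be a value of $\gamma$ that minimizes the total losses $\|\mathcal{S}^{\mathrm{DAPI}}\|_2^2$ in the presence of the measurement noise $\eta$, and let $\gamma^\star$ be a value of $\gamma$ that is optimal in its absence, i.e. minimizes $\|\mathcal{S}^{\mathrm{DAPI}}_P\|_2^2$. Then $$\gamma^{\star,\eta}>\gamma^\star.$$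
   Context: $\mathcal{G}^P$ is a connected undirected graph on $n\ge2$ nodes with edge weights $b_{ij}=b_{ji}>0$ and weighted Laplacian $\mathcal{L}_B$, whose eigenvalues are $0=\lambda_1<\lambda_2\le\dots\le\lambda_n$. The network is a linearized power network controlled by the distributed averaging PI (DAPI) controller, with uniform conductance-to-susceptance ratio $\alpha$, droop gain $k$, time constant $\tau$, integral gain $q$, and distributed averaging gains $c_{ij}=\gamma b_{ij}$, subject to power injection noise $P$ and frequency measurement noise $\eta$ of relative intensity governed by $\varepsilon$. The expected transient power losses (squared $\mathcal{H}_2$ norms) are $$\|\mathcal{S}^{\mathrm{DAPI}}_P\|_2^2=\frac{\alpha}{2k}\sum_{i=2}^n\frac{1}{1+\varphi(\lambda_i,\gamma,k,q,\tau)^{-1}},\qquad \|\mathcal{S}^{\mathrm{DAPI}}_\eta\|_2^2=\varepsilon^2\frac{\alpha}{2k}\sum_{i=2}^n\frac{1}{\gamma\lambda_i}\cdot\frac{1}{1+\varphi(\lambda_i,\gamma,k,q,\tau)},$$ where $$\varphi(\lambda_i,\gamma,k,q,\tau)=\frac{kq^2\lambda_i+q\gamma\lambda_i+\tau(\gamma\lambda_i)^2}{q+\tau\gamma\lambda_i}.$$ The range of $\gamma$ is $[0,\infty)$ for $\|\mathcal{S}^{\mathrm{DAPI}}_P\|_2^2$ (the value $\gamma^\star=0$ is allowed) and $(0,\infty)$ for $\|\mathcal{S}^{\mathrm{DAPI}}\|_2^2$ (the losses tend to $+\infty$ as $\gamma\to0$). *)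

(* Defs.v *)
From HB Require Import structures.
From mathcomp Require Import all_boot all_order all_algebra.
From mathcomp Require Import boolp classical_sets reals.

Set Implicit Arguments.
Unset Strict Implicit.
Unset Printing Implicit Defensive.

Import Order.TTheory GRing.Theory Num.Theory.

Local Open Scope classical_set_scope.
Local Open Scope ring_scope.

Section Network.
Context {R : realType} {n : nat}.

(* Only the values of b on the edges of e matter. *)
Definition weighted_graph (e : rel 'I_n) (b : 'I_n -> 'I_n -> R) : Prop :=
  [/\ symmetric e,
      irreflexive e,
      forall i j, e i j -> b i j = b j i &
      forall i j, e i j -> 0 < b i j].

Definition connected_graph (e : rel 'I_n) : Prop :=
  forall i j, connect e i j.

Definition laplacian (e : rel 'I_n) (b : 'I_n -> 'I_n -> R) : 'M[R]_n :=
  \matrix_(i, j)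
    if i == j then \sum_(k | e i k) b i k
    else if e i j then - b i j else 0.

(* Eigenvalues listed with algebraic multiplicity, in nondecreasing order. *)
Definition ordered_eigenvalues (A : 'M[R]_n) (lam : n.-tuple R) : Prop :=
  sorted <=%R lam /\ char_poly A = \prod_(l <- lam) ('X - l%:P).

End Network.

Section Losses.
Context {R : realType}.

Definition phi (l gamma k q tau : R) : R :=
  (k * q ^+ 2 * l + q * gamma * l + tau * (gamma * l) ^+ 2)
  / (q + tau * gamma * l).

(* The eigenvalues are indexed from 0, so that 1 <= i < n skips exactly the
   smallest one.  These are the closed forms of the squared H2 norms of the
   DAPI-controlled network from P, resp. eta, to the transient losses. *)
Definition loss_P n (lam : n.-tuple R) (alpha k q tau gamma : R) : R :=
  alpha / (2 * k) *
  \sum_(1 <= i < n) 1 / (1 + (phi lam`_i gamma k q tau)^-1).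

(* Meaningful for gamma > 0 only: at gamma = 0 the convention 0^-1 = 0 would
   give 0, where the losses are in fact infinite. *)
Definition loss_eta n (lam : n.-tuple R) (alpha k q tau eps gamma : R) : R :=
  eps ^+ 2 * (alpha / (2 * k)) *
  \sum_(1 <= i < n)
     1 / (gamma * lam`_i) * (1 / (1 + phi lam`_i gamma k q tau)).

Definition loss_total n (lam : n.-tuple R) (alpha k q tau eps gamma : R) : R :=
  loss_P lam alpha k q tau gamma + loss_eta lam alpha k q tau eps gamma.

Definition minimizes_on (D : set R) (f : R -> R) (x : R) : Prop :=
  D x /\ forall y, D y -> f x <= f y.

End Losses.

(* Main.v *)
Require Import Defs.
From HB Require Import structures.
From mathcomp Require Import all_boot all_order all_algebra.
From mathcomp Require Import boolp classical_sets reals.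
From mathcomp Require Import functions topology normedtype derive realfun.
From mathcomp Require Import ring.

(** The measurement noise only adds a penalty that strictly decreases with the
    interaction strength [g], so it pushes the optimum to the right.

    With [x = g * l], the mode of eigenvalue [l > 0] contributes to [loss_eta]
    a positive multiple of
      [1 / (x * (1 + phi)),  x * phi = x ^ 2 + k q ^ 2 l * (x / (q + tau x))].
    Although [phi] itself need not be monotone in [g], the product [x * phi] is
    increasing, because [x / (q + tau x)] is.  The derivative of its inverse is
    even strictly negative ([is_derive_loss_eta_term]), hence so is that of
    [loss_eta] ([is_derive_loss_eta]).

    Let [c] minimize [loss_P], let [a] minimize the sum of both losses, and
    suppose [a <= c] ([minimizer_shift]).  If [a < c], then moving from [a] to
    [c] does not increase [loss_P] and strictly decreases [loss_eta], against
    the choice of [a].  If [a = c], this point is positive, hence interior to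
    both domains and critical for both [loss_P] and the sum; the derivative of
    [loss_eta] would then vanish there.  The second case is why a strictly
    negative derivative is needed and strict monotonicity is not enough.

    All this needs every eigenvalue but the first to be positive
    ([ordered_eigenvalue_gt0]).  Eigenvalues of the Laplacian are nonnegative
    because its quadratic form is a sum of squares, which vanishes only on
    constant vectors since the graph is connected.  As the eigenvalues are the
    roots of the characteristic polynomial, 0 must moreover be shown to be a
    root of algebraic multiplicity one ([laplacian_zero_simple]); this is done
    by exhibiting the cofactor of ['X] as a determinant
    ([char_poly_zero_row_sum]) that does not vanish at 0. *)

Set Implicit Arguments.
Unset Strict Implicit.

Import Order.TTheory GRing.Theory Num.Theory.
Import numFieldNormedType.Exports.

Local Open Scope classical_set_scope.
Local Open Scope ring_scope.

(** * Spectrum of the weighted Laplacian *)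

Lemma mul_row_laplacian (R : realType) n (e : rel 'I_n) (b : 'I_n -> 'I_n -> R)
    (v : 'rV_n) i :
  weighted_graph e b ->
  (v *m laplacian e b) 0 i = \sum_(j | e i j) b i j * (v 0 i - v 0 j).
Proof.
move=> [esym eirr bsym _]; rewrite mxE (bigD1 i) //= mxE eqxx.
transitivity (v 0 i * (\sum_(j | e i j) b i j) - \sum_(j | e i j) b i j * v 0 j).
  congr (_ + _); rewrite -sumrN.
  rewrite [LHS]big_mkcond [RHS]big_mkcond; apply: eq_bigr => j _ /=.
  case: eqVneq => [->|/negPf ji]; first by rewrite eirr.
  rewrite mxE ji esym; case: ifP => [eij|_]; last by rewrite mulr0.
  by rewrite (bsym _ _ eij) mulrN mulrC.
rewrite big_distrr -sumrB; apply: eq_bigr => j _ /=.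
by rewrite mulrC mulrBr.
Qed.

Lemma laplacian_row_sum (R : realType) n (e : rel 'I_n) (b : 'I_n -> 'I_n -> R) i :
  weighted_graph e b -> \sum_j laplacian e b i j = 0.
Proof.
move=> [_ eirr _ _]; rewrite (bigD1 i) //= mxE eqxx.
apply/eqP; rewrite addr_eq0 -sumrN; apply/eqP.
rewrite [LHS]big_mkcond [RHS]big_mkcond; apply: eq_bigr => j _ /=.
rewrite mxE; case: (eqVneq j i) => [->|/negPf ji]; first by rewrite eirr.
by case: ifP; rewrite ?opprK ?oppr0.
Qed.

(** Each edge is visited in both directions, and averaging the terms of
    [(i, j)] and [(j, i)] turns [v i (v i - v j)] into half a square; hence
    the factor 2. *)
Lemma laplacian_dirichlet (R : realType) n (e : rel 'I_n) (b : 'I_n -> 'I_n -> R)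
    (v : 'rV_n) :
  weighted_graph e b ->
  \sum_i v 0 i * (v *m laplacian e b) 0 i *+ 2 =
  \sum_i \sum_(j | e i j) b i j * (v 0 i - v 0 j) ^+ 2.
Proof.
move=> hG; have [esym _ bsym _] := hG.
pose S (F : 'I_n -> 'I_n -> R) := \sum_i \sum_(j | e i j) F i j.
have S_swap F : S F = S (fun i j => F j i).
  rewrite /S (exchange_big_dep xpredT) //=.
  by apply: eq_bigr => i _; apply: eq_bigl => j.
rewrite -[RHS]/(S (fun i j => b i j * (v 0 i - v 0 j) ^+ 2)).
transitivity (S (fun i j => v 0 i * (b i j * (v 0 i - v 0 j))) *+ 2).
  rewrite /S -sumrMnl; apply: eq_bigr => i _.
  by rewrite mul_row_laplacian // big_distrr.
rewrite mulr2n {2}S_swap /S -big_split /=; apply: eq_bigr => i _.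
rewrite -big_split; apply: eq_bigr => j eij /=; rewrite -(bsym _ _ eij); ring.
Qed.

Lemma laplacian_eigenvalue_ge0 (R : realType) n (e : rel 'I_n)
    (b : 'I_n -> 'I_n -> R) a :
  weighted_graph e b -> eigenvalue (laplacian e b) a -> 0 <= a.
Proof.
move=> hG /eigenvalueP[v va v0]; have [_ _ _ bpos] := hG.
have sq_gt0 : 0 < \sum_i v 0 i ^+ 2.
  rewrite lt_def sumr_ge0 ?andbT => [|i _]; last exact: sqr_ge0.
  apply: contraNneq v0 => s0; apply/eqP/rowP => i; rewrite mxE.
  have /eqP := s0; rewrite psumr_eq0 => [|j _]; last exact: sqr_ge0.
  by move=> /allP/(_ i (mem_index_enum _)); rewrite sqrf_eq0 => /eqP.
have : 0 <= \sum_i v 0 i * (v *m laplacian e b) 0 i *+ 2.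
  rewrite laplacian_dirichlet //; apply: sumr_ge0 => i _; apply: sumr_ge0 => j eij.
  by rewrite mulr_ge0 ?sqr_ge0 // ltW // bpos.
rewrite va sumrMnl pmulrn_lge0 // (eq_bigr (fun i => a * v 0 i ^+ 2)).
  by rewrite -big_distrr /= pmulr_lge0.
by move=> i _; rewrite mxE; ring.
Qed.

(** A sum of nonnegative terms vanishes only if each of them does, so [v]
    agrees at the two ends of every edge, hence along every path. *)
Lemma laplacian_kernel_constant (R : realType) n (e : rel 'I_n)
    (b : 'I_n -> 'I_n -> R) (v : 'rV_n) :
  weighted_graph e b -> connected_graph e -> v *m laplacian e b = 0 ->
  forall i j, v 0 i = v 0 j.
Proof.
move=> hG hconn vL0 i j; have [_ _ _ bpos] := hG.
have term_ge0 k l : e k l -> 0 <= b k l * (v 0 k - v 0 l) ^+ 2.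
  by move=> ekl; rewrite mulr_ge0 ?sqr_ge0 // ltW // bpos.
have edge k l : e k l -> v 0 k = v 0 l.
  move=> ekl; have := laplacian_dirichlet v hG.
  rewrite big1 => [|m _]; last by rewrite vL0 mxE mulr0 mul0rn.
  move/esym/eqP; rewrite psumr_eq0 => [|m _]; last first.
    by apply: sumr_ge0 => ? /term_ge0.
  move=> /allP/(_ k (mem_index_enum _)) /=.
  rewrite psumr_eq0 => [|m /term_ge0 //].
  move=> /allP/(_ l (mem_index_enum _)); rewrite ekl /= mulf_eq0.
  by rewrite gt_eqF ?bpos //= sqrf_eq0 subr_eq0 => /eqP.
have /connectP[p ep ->] := hconn i j.
by elim: p i ep => //= k p IH i /andP[/edge -> /IH].
Qed.

Definition with_ones_column (S : pzSemiRingType) m (A : 'M[S]_m.+1) : 'M[S]_m.+1 :=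
  \matrix_(i, j) if j == 0 then 1 else A i j.

(** Adding all columns of ['X - A] to the first one turns that column into
    ['X, ..., 'X], and ['X] factors out of the determinant. *)
Lemma char_poly_zero_row_sum (S : comNzRingType) m (A : 'M[S]_m.+1) :
  (forall i, \sum_j A i j = 0) ->
  char_poly A = \det (with_ones_column (char_poly_mx A)) * 'X.
Proof.
(* Multiplying by P on the right adds all columns to the first; multiplying
   by diag_mx D scales the first column by 'X. *)
move=> rowA; pose P : 'M[{poly S}]_m.+1 := with_ones_column 1%:M.
pose D : 'rV[{poly S}]_m.+1 := \row_j if j == 0 then 'X else 1.
have detP : \det P = 1.
  rewrite det_trig; first by rewrite big1 // => i _; rewrite !mxE eqxx; case: eqP.
  apply/is_trig_mxP => i j ij; rewrite !mxE.
  by case: eqP ij => [->|_ ij] //; rewrite -val_eqE ltn_eqF.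
have detD : \det (diag_mx D) = 'X.
  rewrite det_diag big_ord_recl mxE eqxx big1 ?mulr1 // => i _.
  by rewrite mxE.
rewrite -detD -det_mulmx -[LHS]mulr1 -detP -det_mulmx; congr (\det _).
apply/matrixP => i j; rewrite mul_mx_diag !mxE; have [->|j0] := eqVneq j 0.
  rewrite mul1r (eq_bigr (char_poly_mx A i)) => [|k _]; last by rewrite !mxE mulr1.
  rewrite (eq_bigr (fun k => 'X *+ (i == k) - (A i k)%:P)) => [|k _].
    rewrite sumrB -rmorph_sum rowA subr0 (bigD1 i) //= eqxx big1 ?addr0 // => k.
    by rewrite eq_sym => /negPf ->.
  by rewrite !mxE.
rewrite mulr1 (bigD1 j) //= !mxE eqxx (negPf j0) mulr1 big1 ?addr0 // => k /negPf kj.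
by rewrite !mxE kj (negPf j0) mulr0.
Qed.

(** If ['X ^+ 2] divided the characteristic polynomial, the cofactor of ['X]
    would vanish at 0, and some [v != 0] would have zero entry sum and kill
    all columns of the Laplacian but the first.  Since the columns add up to 0,
    it also kills the first, so [v] is constant, and its zero sum makes it 0. *)
Lemma laplacian_zero_simple (R : realType) m (e : rel 'I_m.+1)
    (b : 'I_m.+1 -> 'I_m.+1 -> R) :
  weighted_graph e b -> connected_graph e ->
  ~~ ('X ^+ 2 %| char_poly (laplacian e b)).
Proof.
move=> hG hconn; set L := laplacian e b.
have rowL i : \sum_j L i j = 0 by exact: laplacian_row_sum.
rewrite char_poly_zero_row_sum // expr2 dvdp_mul2r ?polyX_eq0 //.
rewrite -['X]subr0 -polyC0 dvdp_XsubCl /root -horner_evalE -det_map_mx.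
apply/negP => /det0P[v v0 vN].
have colv j : (v *m map_mx (horner_eval 0)
    (with_ones_column (char_poly_mx L))) 0 j =
    if j == 0 then \sum_i v 0 i else - (v *m L) 0 j.
  rewrite mxE; case: eqP => [->|/eqP/negPf j0].
    by apply: eq_bigr => i _; rewrite !mxE /horner_eval hornerC mulr1.
  rewrite mxE -sumrN; apply: eq_bigr => i _; rewrite !mxE j0 /horner_eval.
  by rewrite hornerD hornerN hornerC hornerMn hornerX mul0rn sub0r mulrN.
have sum_v : \sum_i v 0 i = 0 by move: (colv 0); rewrite vN mxE eqxx => <-.
have vL_off j : j != 0 -> (v *m L) 0 j = 0.
  by move=> /negPf j0; apply/eqP; rewrite -oppr_eq0; move: (colv j);
    rewrite vN mxE j0 => <-.
have vL0 : v *m L = 0.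
  apply/rowP => j; rewrite [RHS]mxE; have [->|/vL_off //] := eqVneq j 0.
  transitivity (\sum_j (v *m L) 0 j).
    by rewrite (bigD1 0) //= big1 ?addr0 // => k /vL_off.
  rewrite (eq_bigr (fun j => \sum_i v 0 i * L i j)) => [|k _]; last by rewrite mxE.
  by rewrite exchange_big big1 // => i _; rewrite -big_distrr /= rowL mulr0.
move/negP: v0; apply; apply/eqP/rowP => i; rewrite [RHS]mxE.
have := sum_v; rewrite (eq_bigr (fun=> v 0 i)) => [|j _].
  by rewrite sumr_const card_ord => /eqP; rewrite mulrn_eq0 => /eqP.
exact: laplacian_kernel_constant hG hconn vL0 j i.
Qed.

Lemma ordered_eigenvalue_gt0 (R : realType) n (e : rel 'I_n)
    (b : 'I_n -> 'I_n -> R) (lam : n.-tuple R) i :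
  weighted_graph e b -> connected_graph e ->
  ordered_eigenvalues (laplacian e b) lam -> (0 < i < n)%N -> 0 < lam`_i.
Proof.
case: n e b lam => [|m] e b lam hG hconn; first by rewrite ltn0 andbF.
move=> [lam_sorted lamE] /andP[i_gt0 lt_im].
have lam_ge0 j : (j < m.+1)%N -> 0 <= lam`_j.
  move=> lt_jm; apply: (laplacian_eigenvalue_ge0 hG).
  by rewrite eigenvalue_root_char lamE root_prod_XsubC mem_nth ?size_tuple.
rewrite lt_def lam_ge0 // andbT; apply/eqP => lami0.
have lam00 : lam`_0 = 0.
  apply/eqP; rewrite eq_le lam_ge0 // andbT -[leRHS]lami0.
  by apply: le_sorted_leq_nth => //; rewrite inE size_tuple.
(* Two zeros among the eigenvalues would make 'X ^+ 2 a factor. *)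
move/negP: (laplacian_zero_simple hG hconn); apply; rewrite lamE.
rewrite (big_nth 0) size_tuple (bigD1_seq 0%N) ?mem_index_iota ?iota_uniq //=.
rewrite -big_filter (bigD1_seq i) ?filter_uniq ?iota_uniq //=; last first.
  by rewrite mem_filter mem_iota /= -lt0n i_gt0.
by rewrite lam00 lami0 polyC0 subr0 mulrA -expr2 dvdp_mulr.
Qed.

(** * Minimizers under a decreasing penalty *)

(** Adding to the objective a penalty [H] with negative derivative moves a
    minimizer strictly to the right: a coinciding minimizer would be critical
    for [F] and [F + H], hence for [H]. *)
Lemma minimizer_shift (R : realType) (F H : R -> R) (a c : R) :
  (forall x : R, 0 < x -> derivable F x 1) ->
  (forall x : R, 0 < x -> derivable H x 1) ->
  (forall x : R, 0 < x -> 'D_1 H x < 0) ->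
  minimizes_on [set x | 0 < x] (fun x => F x + H x) a ->
  minimizes_on [set x | 0 <= x] F c -> c < a.
Proof.
move=> derF derH DH_lt0 [/= a0 mina] [/= c0 minc].
rewrite ltNge le_eqVlt; apply/negP => /predU1P[ac|ac].
  have critical (f : R -> R) : (forall x : R, 0 < x -> derivable f x 1) ->
      (forall y, 0 < y -> f a <= f y) -> 'D_1 f a = 0.
    move=> derf minf.
    have a_in : a \in `]0, (a *+ 2)[ by rewrite in_itv /= a0 mulr2n ltrDl.
    have [|t|t|_ ->//] := @derive1_at_min _ f 0 (a *+ 2) a _ _ a_in.
    - by rewrite mulrn_wge0 // ltW.
    - by rewrite in_itv => /andP[/derf].
    - by rewrite in_itv => /andP[/minf].
  have DFa : 'D_1 F a = 0 by apply: critical => // y y0; rewrite ac minc //= ltW.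
  have : 'D_1 (F + H) a = 0.
    by apply: critical => [x x0|y /mina //]; apply: derivableD; auto.
  rewrite deriveD; [|auto|auto].
  by rewrite DFa add0r; apply/eqP; rewrite lt_eqF // DH_lt0.
have Hca : H c < H a.
  have pos (x : R) : x \in `[a, c] -> 0 < x.
    by rewrite in_itv => /andP[+ _]; exact: lt_le_trans.
  have sub (x : R) : x \in `]a, c[ -> 0 < x.
    by rewrite in_itv => /andP[+ _]; exact: lt_trans.
  apply: (@ltr0_derive1_lt_cc R H a c); rewrite ?in_itv /= ?lexx ?ltW //.
  - by move=> x /sub; exact: derH.
  - by move=> x /sub; rewrite derive1E; exact: DH_lt0.
  - by apply: derivable_within_continuous => x /pos; exact: derH.
have := mina c (lt_trans a0 ac); rewrite leNgt => /negP; apply.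
by rewrite ler_ltD // minc //= ltW.
Qed.

(** * Derivatives of the losses *)

Section Mode.
Context {R : realType} (l k q tau : R).
Context (l0 : 0 < l) (k0 : 0 < k) (q0 : 0 < q) (t0 : 0 < tau).

Lemma is_derive_phi (g : R) : 0 <= g ->
  is_derive g 1 (fun y => phi l y k q tau)
    (l - k * q ^+ 2 * l * (tau * l) / (q + tau * g * l) ^+ 2).
Proof.
move=> g0; have d0 : q + tau * g * l != 0.
  by rewrite gt_eqF // ltr_pwDl // !mulr_ge0 // ltW.
pose N : {poly R} := (k * q ^+ 2 * l)%:P + (q * l) *: 'X + (tau * l ^+ 2) *: 'X^2.
pose D : {poly R} := q%:P + (tau * l) *: 'X.
have NE y : N.[y] = k * q ^+ 2 * l + q * y * l + tau * (y * l) ^+ 2.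
  by rewrite /N !(hornerC, hornerD, hornerZ, hornerX, hornerXn); ring.
have DE y : D.[y] = q + tau * y * l.
  by rewrite /D !(hornerC, hornerD, hornerZ, hornerX); ring.
rewrite (_ : (fun y => _) = horner N * (fun y => (D.[y])^-1)); last first.
  by apply/funext => y; rewrite /phi -NE -DE.
have d1 : D.[g] != 0 by rewrite DE.
have isV := is_deriveV d1 (is_derive_poly D g).
apply: is_derive_eq (is_deriveM (is_derive_poly N g) isV) _.
rewrite NE DE /N /D !(derivD, derivC, derivZ, derivX, derivXn) /=.
rewrite !(hornerD, hornerC, hornerZ, hornerX, hornerMn) /GRing.scale /=.
by field.
Qed.

Lemma phi_gt0 (g : R) : 0 <= g -> 0 < phi l g k q tau.
Proof.
move=> g0; rewrite /phi divr_gt0 //; last by rewrite ltr_pwDl // !mulr_ge0 // ltW.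
rewrite -addrA ltr_pwDl ?mulr_gt0 ?exprn_gt0 //.
by rewrite addr_ge0 // !mulr_ge0 ?sqr_ge0 // ltW.
Qed.

Lemma derivable_loss_P_term (g : R) : 0 <= g ->
  derivable (fun y => 1 / (1 + (phi l y k q tau)^-1)) g 1.
Proof.
move=> g0; have f0 := phi_gt0 g0.
have h := @is_deriveV R _ g _ 1 (lt0r_neq0 f0) (is_derive_phi g0).
have h1 := is_deriveD (is_derive_cst (1 : R) g 1) h.
rewrite (_ : (fun y => _) =
  fun y => ((cst 1 + (fun y => (phi l y k q tau)^-1)) y)^-1); last first.
  by apply/funext => y; rewrite div1r.
apply: derivableV; last by case: h1.
by rewrite lt0r_neq0 //= addr_gt0 // invr_gt0.
Qed.

(** Up to sign and a square, the derivative of the inverse of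
    [f y = y l (1 + phi y)] is that of [f], in which the negative part of the
    derivative of [phi] cancels; the explicit value [w] below has only
    positive terms. *)
Lemma is_derive_loss_eta_term (g : R) : 0 < g ->
  exists2 d, d < 0 &
    is_derive g 1 (fun y => 1 / (y * l) * (1 / (1 + phi l y k q tau))) d.
Proof.
move=> g0; have f0 := phi_gt0 (ltW g0).
have d0 : 0 < q + tau * g * l by rewrite ltr_pwDl // !mulr_ge0 // ltW.
pose f y := y * l * (1 + phi l y k q tau).
have fg : 0 < f g by rewrite /f !mulr_gt0 // addr_gt0.
pose w := l + 2 * l ^+ 2 * g + k * q ^+ 3 * l ^+ 2 / (q + tau * g * l) ^+ 2.
have w0 : 0 < w by rewrite /w !addr_gt0 ?divr_gt0 ?mulr_gt0 ?exprn_gt0.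
have df : is_derive g 1 f w.
  have h := is_deriveM (is_deriveM (is_derive_id g 1) (is_derive_cst l g 1))
     (is_deriveD (is_derive_cst (1 : R) g 1) (is_derive_phi (ltW g0))).
  apply: is_derive_eq h _; rewrite /w /phi /GRing.scale /= !fctE /=.
  by field; rewrite lt0r_neq0.
exists (- (f g) ^- 2 *: w).
  by rewrite /GRing.scale /= mulNr oppr_lt0 mulr_gt0 // invr_gt0 exprn_gt0.
rewrite (_ : (fun y => _) = fun y => (f y)^-1).
  exact: is_deriveV (lt0r_neq0 fg) df.
by apply/funext => y; rewrite !div1r -invfM.
Qed.
End Mode.

Lemma is_derive_sum_seq (R : realType) (I : eqType) (r : seq I)
    (F : I -> R -> R) (dF : I -> R) (x : R) :
  (forall i, i \in r -> is_derive x 1 (F i) (dF i)) ->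
  is_derive x 1 (fun y => \sum_(i <- r) F i y) (\sum_(i <- r) dF i).
Proof.
elim: r => [|i r IH] isF.
  rewrite big_nil (_ : (fun _ => _) = cst 0); first exact: is_derive_cst.
  by apply/funext => y; rewrite big_nil.
rewrite big_cons (_ : (fun _ => _) = F i + (fun y => \sum_(i <- r) F i y)).
  apply: is_deriveD; first by apply: isF; rewrite mem_head.
  by apply: IH => j jr; apply: isF; rewrite inE jr orbT.
by apply/funext => y; rewrite big_cons.
Qed.

Section Losses.
Context {R : realType} {n : nat} (lam : n.-tuple R) (alpha k q tau eps : R).
Context (alpha0 : 0 < alpha) (k0 : 0 < k) (q0 : 0 < q) (t0 : 0 < tau).
Context (eps0 : 0 < eps) (lam0 : forall i, (0 < i < n)%N -> 0 < lam`_i).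

Lemma derivable_loss_P (g : R) : 0 <= g ->
  derivable (loss_P lam alpha k q tau) g 1.
Proof.
move=> g0; apply: derivableZ.
suff h : is_derive g 1
   (fun y => \sum_(1 <= i < n) 1 / (1 + (phi lam`_i y k q tau)^-1))
   (\sum_(1 <= i < n) 'D_1 (fun y => 1 / (1 + (phi lam`_i y k q tau)^-1)) g).
  by case: h.
apply: is_derive_sum_seq => i; rewrite mem_index_iota => i_in.
by apply: derivableP; apply: derivable_loss_P_term => //; exact: lam0.
Qed.

Lemma is_derive_loss_eta (g : R) : (1 < n)%N -> 0 < g ->
  exists2 d, d < 0 & is_derive g 1 (loss_eta lam alpha k q tau eps) d.
Proof.
move=> n1 g0.
pose h i y := 1 / (y * lam`_i) * (1 / (1 + phi lam`_i y k q tau)).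
have hP i : (0 < i < n)%N -> derivable (h i) g 1 /\ 'D_1 (h i) g < 0.
  move=> /lam0 li; have [d d0 [dh dE]] := is_derive_loss_eta_term li k0 q0 t0 g0.
  by split; rewrite // dE.
exists ((eps ^+ 2 * (alpha / (2 * k))) *: \sum_(1 <= i < n) 'D_1 (h i) g).
  rewrite /GRing.scale /= pmulr_rlt0 ?mulr_gt0 ?exprn_gt0 ?invr_gt0 ?mulr_gt0 //.
  rewrite big_ltn // -[ltRHS]addr0 ltr_leD ?(hP 1%N _).2 //.
  rewrite big_nat sumr_le0 // => i /andP[i2 lt_in].
  by rewrite ltW // (hP i _).2 // lt_in (ltn_trans _ i2).
apply: is_deriveZ; apply: is_derive_sum_seq => i; rewrite mem_index_iota => i_in.
by apply: derivableP; apply: (hP i i_in).1.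
Qed.
End Losses.

(** * Comparison of the optimal interaction strengths *)

Theorem proposition3p5 (R : realType) (n : nat) (hn : (2 <= n)%N)
  (e : rel 'I_n) (b : 'I_n -> 'I_n -> R)
  (hG : weighted_graph e b) (hconn : connected_graph e)
  (lam : n.-tuple R) (hlam : ordered_eigenvalues (laplacian e b) lam)
  (alpha k q tau eps : R)
  (halpha : 0 < alpha) (hk : 0 < k) (hq : 0 < q) (htau : 0 < tau)
  (heps : 0 < eps)
  (gamma_eta gamma_star : R)
  (heta : minimizes_on [set g | 0 < g]
            (loss_total lam alpha k q tau eps) gamma_eta)
  (hstar : minimizes_on [set g | 0 <= g]
             (loss_P lam alpha k q tau) gamma_star) :
  gamma_eta > gamma_star.
Proof.
have lam0 i := @ordered_eigenvalue_gt0 R n e b lam i hG hconn hlam.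
have eta_lt0 g (g0 : 0 < g) := is_derive_loss_eta
  halpha hk hq htau heps lam0 hn g0.
apply: minimizer_shift heta hstar => g g0.
- by apply: derivable_loss_P => //; exact: ltW.
- by have [d _ []] := eta_lt0 g g0.
- by have [d d0 [_ ->]] := eta_lt0 g g0.
Qed.
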